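(* Let $(\Gamma,\omega,\Phi)$ be a classical Poincaré-invariant system with timelike future-directed four-momentum. Let $\chi$ be an SSC position observable, i.e. there is a map $f\colon\mathsf{SpHP}\times\Gamma\to V$ with values in the future-directed timelike vectors such that $\chi$ is the SSC position observable with respect to $f$. Suppose that for each $\gamma\in\Gamma$ the map $\Sigma\mapsto\chi(\Sigma)(\gamma)$ is continuous, and that $\chi$ is a centre of spin. Then $\chi=\chi^{\mathrm{NW}}$.
   Context: Minkowski spacetime: affine space $M$ over a 4-dimensional real vector space $V$ with metric $\eta$ of signature $(-,+,+,+)$, fixed orientation and time orientation, fixed origin identifying $M$ with $V$. $u\cdot v:=\eta(u,v)$, indices lowered/raised with $\eta$; $\varepsilon$ is the volume form with $\varepsilon_{0123}=+1$ in positively oriented orthonormal bases; $c>0$. $\mathsf{SpHP}$ is the set of spacelike hyperplanes, each identified with $(u,\tau)$ ($u$ future-directed unit timelike normal, $\tau\in\mathbb R$, $\Sigma=\{x:u\cdot x=-\tau\}$), topologised as a subset of (unit hyperboloid)$\times\mathbb R$. A classical Poincaré-invariant system has phase-space functions $P_\mu$ and $J_{\mu\nu}=-J_{\nu\mu}$; $m=\sqrt{-P\cdot P}/c$. A position observable is a map $\chi\colon\mathsf{SpHP}\times\Gamma\to M$ with $u_\mu\chi^\mu(u,\tau)=-\tau$ and $\partial\chi_\mu/\partial\tau=P_\mu/(-u\cdot P)$; spin tensor $S(u)_{\mu\nu}=J_{\mu\nu}-\chi_\mu(u,\tau)P_\nu+\chi_\nu(u,\tau)P_\mu$. SSC position observable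 with respect to $f$: $\chi_\mu(u,\tau)=\frac{J_{\mu\rho}f^\rho}{f\cdot P}+\frac{\tau P_\mu}{(-u\cdot P)}-\frac{J_{\lambda\rho}u^\lambda f^\rho}{(-f\cdot P)}\frac{P_\mu}{(-u\cdot P)}$ (intersection of $\Sigma$ with the line of solutions $x$ of $(J_{\mu\nu}-x_\mu P_\nu+x_\nu P_\mu)f^\nu=0$). Pauli–Lubański vector $W_\mu=-\tfrac12\varepsilon_{\mu\nu\rho\sigma}P^\nu J^{\rho\sigma}$; spin vector $s(u)=B(u)W/(mc)$ with $B^\mu{}_\nu(u)=\delta^\mu_\nu+\frac{(P^\mu/(mc)+u^\mu)(P_\nu/(mc)+u_\nu)}{1-u\cdot P/(mc)}-2\frac{u^\mu P_\nu}{mc}$. $\chi$ is a centre of spin if $s_\mu(u)=-\tfrac12\varepsilon_{\mu\nu\rho\sigma}u^\nu S^{\rho\sigma}(u)$ for all $(u,\tau)$ and phase-space points. Newton–Wigner observable $\chi^{\mathrm{NW}}$: the SSC position observable with $f=u+P/(mc)$, explicitly $\chi^{\mathrm{NW}}_\mu(u,\tau)=-\frac{J_{\mu\rho}(u^\rho+P^\rho/(mc))}{mc-u\cdot P}+\frac{\tau P_\mu}{(-u\cdot P)}-\frac{J_{\lambda\rho}u^\lambda P^\rho}{mc(mc-u\cdot P)}\frac{P_\mu}{(-u\cdot P)}$. *)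

(* Defs.v *)
From HB Require Import structures.
From mathcomp Require Import all_boot all_order all_algebra.
From mathcomp Require Import all_classical all_reals all_analysis.
Set Implicit Arguments. Unset Strict Implicit. Unset Printing Implicit Defensive.
Import Order.TTheory GRing.Theory Num.Theory.
Import numFieldNormedType.Exports.
Local Open Scope ring_scope.

(* Minkowski spacetime in a positively oriented, time-oriented orthonormal
   basis: vectors are rows 'rV[R]_4 of CONTRAVARIANT components x^mu,
   index 0 is time, eta = diag(-1,1,1,1). *)
Section Minkowski.
Variable R : realType.
Implicit Types (u v : 'rV[R]_4) (M : 'M[R]_4).

Definition cmp v (i : 'I_4) : R := v ord0 i.

Definition etad (i : 'I_4) : R := if i == ord0 then -1 else 1.

Definition mdot u v : R := \sum_(i < 4) etad i * cmp u i * cmp v i.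

Definition low v (i : 'I_4) : R := etad i * cmp v i.

Definition future_timelike v : Prop := mdot v v < 0 /\ 0 < cmp v ord0.

Definition unit_future v : Prop := mdot v v = -1 /\ 0 < cmp v ord0.

(* SpHP, identified with pairs (u, tau) in (unit hyperboloid) x R,
   Sigma = {x | u . x = - tau}; topologised as a subset of 'rV_4 * R. *)
Definition SpHP : set ('rV[R]_4 * R) := [set p | unit_future p.1].

(* Levi-Civita symbol with lower indices, eps_{0123} = +1 *)
Definition eps (a b c d : 'I_4) : R :=
  let s := [:: a; b; c; d] in
  \prod_(i < 4) \prod_(j < 4 | (i < j)%N)
     Num.sg ((nth ord0 s j)%:R - (nth ord0 s i)%:R : R).

Definition mc (P : 'rV[R]_4) : R := Num.sqrt (- mdot P P).

Definition ssc_pos (f u : 'rV[R]_4) (tau : R) (P : 'rV[R]_4) M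
  : 'rV[R]_4 :=
  \row_mu (etad mu *
    ((\sum_(rho < 4) M mu rho * cmp f rho) / mdot f P
     + tau * low P mu / (- mdot u P)
     - (\sum_(la < 4) \sum_(rho < 4) M la rho * cmp u la * cmp f rho)
         / (- mdot f P) * (low P mu / (- mdot u P)))).

Definition nw_pos (u : 'rV[R]_4) (tau : R) (P : 'rV[R]_4) M : 'rV[R]_4 :=
  \row_mu (etad mu *
    (- (\sum_(rho < 4) M mu rho * (cmp u rho + cmp P rho / mc P))
         / (mc P - mdot u P)
     + tau * low P mu / (- mdot u P)
     - (\sum_(la < 4) \sum_(rho < 4) M la rho * cmp u la * cmp P rho)
         / (mc P * (mc P - mdot u P)) * (low P mu / (- mdot u P)))).

Definition spin_tensor (x P : 'rV[R]_4) M : 'M[R]_4 :=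
  \matrix_(mu < 4, nu < 4)
    (M mu nu - low x mu * low P nu + low x nu * low P mu).

Definition PL_low (P : 'rV[R]_4) M (mu : 'I_4) : R :=
  - (1 / 2) * \sum_(nu < 4) \sum_(rho < 4) \sum_(sg < 4)
     eps mu nu rho sg * cmp P nu * (etad rho * etad sg * M rho sg).

Definition Bmat (u P : 'rV[R]_4) (mu nu : 'I_4) : R :=
  (if mu == nu then 1 else 0)
  + (cmp P mu / mc P + cmp u mu) * (low P nu / mc P + low u nu)
      / (1 - mdot u P / mc P)
  - 2 * cmp u mu * low P nu / mc P.

Definition spin_vec (u P : 'rV[R]_4) M : 'rV[R]_4 :=
  \row_mu ((\sum_(nu < 4) Bmat u P mu nu * (etad nu * PL_low P M nu))
                / mc P).

Definition centre_of_spin_at (u x P : 'rV[R]_4) M : Prop :=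
  forall mu : 'I_4,
    low (spin_vec u P M) mu =
    - (1 / 2) * \sum_(nu < 4) \sum_(rho < 4) \sum_(sg < 4)
        eps mu nu rho sg * cmp u nu *
        (etad rho * etad sg * spin_tensor x P M rho sg).

End Minkowski.
Arguments SpHP {R}.

(* Main.v *)
Require Import Defs.
From HB Require Import structures.
From mathcomp Require Import all_boot all_order all_algebra.
From mathcomp Require Import all_classical all_reals all_analysis.
From mathcomp Require Import ring lra.
Import Order.TTheory GRing.Theory Num.Theory.
Import numFieldNormedType.Exports.
Local Open Scope classical_set_scope.
Local Open Scope ring_scope.
(** Let W be the Pauli-Lubanski vector, g = u + P/(mc), and put
    d = f/(f.P) - g/(g.P).  Along the line cut out by the supplementary condition
    the observable depends linearly on f/(f.P), so chi = chi^NW as soon as J d is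
    proportional to P.

    If S f = 0, contracting the cyclic identity for the dual of S expresses the
    spin of S relative to u through W and f, and the centre-of-spin condition becomes
    (u.W) d = (f.u/(f.P) - 1/(mc)) W.  Since J W is always proportional to P, this
    settles the case u.W <> 0.  If W = 0, J d is proportional to P for every d
    orthogonal to P.  If W <> 0 but u.W = 0, then W is spacelike, u is a limit of
    hyperboloid points u_t with u_t.W <> 0, and continuity of chi concludes. *)

Set Implicit Arguments.
Unset Strict Implicit.

(** * Coordinates and the Levi-Civita symbol *)

Definition o0 : 'I_4 := @Ordinal 4 0 isT.
Definition o1 : 'I_4 := @Ordinal 4 1 isT.
Definition o2 : 'I_4 := @Ordinal 4 2 isT.
Definition o3 : 'I_4 := @Ordinal 4 3 isT.

Lemma ord4_ind (Q : 'I_4 -> Prop) :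
  Q o0 -> Q o1 -> Q o2 -> Q o3 -> forall i, Q i.
Proof.
move=> q0 q1 q2 q3 [[|[|[|[|//]]]] lt_n].
- by rewrite (_ : Ordinal _ = o0) //; apply: val_inj.
- by rewrite (_ : Ordinal _ = o1) //; apply: val_inj.
- by rewrite (_ : Ordinal _ = o2) //; apply: val_inj.
- by rewrite (_ : Ordinal _ = o3) //; apply: val_inj.
Qed.

Lemma sum_ord4 (V : nmodType) (F : 'I_4 -> V) :
  \sum_(i < 4) F i = F o0 + F o1 + F o2 + F o3.
Proof.
rewrite !big_ord_recr big_ord0 /= add0r.
by congr (F _ + F _ + F _ + F _); apply: val_inj.
Qed.

Section Algebra.
Variable R : realType.
Implicit Types (u v f P d : 'rV[R]_4) (M : 'M[R]_4) (i : 'I_4).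

Lemma etadE :
  (etad R o0 = -1) * (etad R o1 = 1) * (etad R o2 = 1) * (etad R o3 = 1).
Proof. by []. Qed.

(** Sign of m - n as an integer: on concrete indices it reduces by computation, which [Num.sg] over
    an abstract real field does not. *)
Definition sgnz (m n : nat) : int :=
  if (n < m)%N then 1%Z else if m == n then 0%Z else (-1)%Z.

Definition epsz (a b c d : nat) : int :=
  sgnz b a * sgnz c a * sgnz d a * sgnz c b * sgnz d b * sgnz d c.

Lemma sgnzE (m n : nat) : Num.sg (m%:R - n%:R : R) = (sgnz m n)%:~R.
Proof.
rewrite /sgnz; case: ltngtP => h /=.
- by rewrite gtr0_sg // subr_gt0 ltr_nat.
- by rewrite ltr0_sg ?rmorphN1 // subr_lt0 ltr_nat.
- by rewrite h subrr sgr0.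
Qed.

Lemma epsE (a b c d : 'I_4) : eps R a b c d = (epsz a b c d)%:~R.
Proof.
rewrite /eps /epsz !rmorphM /= -!sgnzE.
rewrite !big_ord_recr big_ord0 /= mul1r.
by do 4![rewrite big_mkcond !big_ord_recr big_ord0 /=];
  rewrite !mul1r ?mulr1 ?mulrA.
Qed.

(* Lower components of - (1/2) eps_{i nu rho sg} v^nu M^{rho sg}; PL_low P M is
   convertible to hodge P M, and star below is the raised version. *)
Definition hodge v M i : R :=
  - (1 / 2) * \sum_(nu < 4) \sum_(rho < 4) \sum_(sg < 4)
     eps R i nu rho sg * cmp v nu * (etad R rho * etad R sg * M rho sg).

Lemma hodgeE v M :
  (hodge v M o0 = - (1 / 2) * (cmp v o1 * (M o2 o3 - M o3 o2)
     + cmp v o2 * (M o3 o1 - M o1 o3) + cmp v o3 * (M o1 o2 - M o2 o1)))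
* (hodge v M o1 = - (1 / 2) * (- cmp v o0 * (M o2 o3 - M o3 o2)
     + cmp v o2 * (M o3 o0 - M o0 o3) - cmp v o3 * (M o2 o0 - M o0 o2)))
* (hodge v M o2 = - (1 / 2) * (- cmp v o0 * (M o3 o1 - M o1 o3)
     - cmp v o1 * (M o3 o0 - M o0 o3) + cmp v o3 * (M o1 o0 - M o0 o1)))
* (hodge v M o3 = - (1 / 2) * (- cmp v o0 * (M o1 o2 - M o2 o1)
     + cmp v o1 * (M o2 o0 - M o0 o2) - cmp v o2 * (M o1 o0 - M o0 o1))).
Proof.
by do ![split]; rewrite /hodge !sum_ord4 !epsE /epsz /sgnz !etadE /=; ring.
Qed.

End Algebra.

(** * Minkowski product, Hodge duality and antisymmetric tensors *)

Section Vectors.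
Variable R : realType.
Implicit Types (u v w x f P d : 'rV[R]_4) (M : 'M[R]_4) (a : R).

Definition star v M : 'rV[R]_4 := \row_i (etad R i * hodge v M i).

(* M_{ij} v^j with the free index raised. *)
Definition act M v : 'rV[R]_4 :=
  \row_i (etad R i * \sum_(j < 4) M i j * cmp v j).

Definition antisym M := forall i j, M i j = - M j i.

Definition wedge u v : 'M[R]_4 := \matrix_(i, j) (low u i * low v j).

Lemma mdotE u v : mdot u v = - (cmp u o0 * cmp v o0) + cmp u o1 * cmp v o1
  + cmp u o2 * cmp v o2 + cmp u o3 * cmp v o3.
Proof. by rewrite /mdot sum_ord4 !etadE !mul1r !mulN1r mulNr. Qed.

Lemma mdotC u v : mdot u v = mdot v u.
Proof. by rewrite !mdotE; ring. Qed.

Lemma mdotDl u v w : mdot (u + v) w = mdot u w + mdot v w.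
Proof. by rewrite !mdotE /cmp !mxE; ring. Qed.

Lemma mdotZl a u v : mdot (a *: u) v = a * mdot u v.
Proof. by rewrite !mdotE /cmp !mxE; ring. Qed.

Lemma mdotBl u v w : mdot (u - v) w = mdot u w - mdot v w.
Proof. by rewrite !mdotE /cmp !mxE; ring. Qed.

Lemma mdotDr u v w : mdot u (v + w) = mdot u v + mdot u w.
Proof. by rewrite !mdotE /cmp !mxE; ring. Qed.

Lemma mdotZr a u v : mdot u (a *: v) = a * mdot u v.
Proof. by rewrite !mdotE /cmp !mxE; ring. Qed.

Lemma cmp_inj u v : (forall i, cmp u i = cmp v i) -> u = v.
Proof. by move=> uv; apply/rowP. Qed.

Lemma lowK u i : etad R i * low u i = cmp u i.
Proof.
by rewrite /low mulrA; elim/ord4_ind: i; rewrite !etadE; ring.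
Qed.

Lemma low_inj u v : (forall i, low u i = low v i) -> u = v.
Proof. by move=> uv; apply: cmp_inj => i; rewrite -!lowK uv. Qed.

Lemma antisymE M : antisym M ->
  (M o0 o0 = 0) * (M o1 o1 = 0) * (M o2 o2 = 0) * (M o3 o3 = 0)
* (M o1 o0 = - M o0 o1) * (M o2 o0 = - M o0 o2) * (M o3 o0 = - M o0 o3)
* (M o2 o1 = - M o1 o2) * (M o3 o1 = - M o1 o3) * (M o3 o2 = - M o2 o3).
Proof.
move=> anti; have diag i : M i i = 0 by have := anti i i; lra.
by do ![split]; first [exact: diag | exact: anti].
Qed.

Lemma cmp_star v M i : cmp (star v M) i = etad R i * hodge v M i.
Proof. by rewrite /cmp mxE. Qed.

Lemma cmp_act M v i :
  cmp (act M v) i = etad R i * (M i o0 * cmp v o0 + M i o1 * cmp v o1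
    + M i o2 * cmp v o2 + M i o3 * cmp v o3).
Proof. by rewrite /cmp mxE sum_ord4. Qed.

Lemma cmp_0 i : cmp (0 : 'rV[R]_4) i = 0.
Proof. by rewrite /cmp mxE. Qed.

Lemma cmpD u v i : cmp (u + v) i = cmp u i + cmp v i.
Proof. by rewrite /cmp mxE. Qed.
Lemma cmpN v i : cmp (- v) i = - cmp v i.
Proof. by rewrite /cmp mxE. Qed.
Lemma cmpZ a v i : cmp (a *: v) i = a * cmp v i.
Proof. by rewrite /cmp mxE. Qed.

Lemma wedgeE u v i j : wedge u v i j = (etad R i * cmp u i) * (etad R j * cmp v j).
Proof. by rewrite mxE. Qed.

Definition coordE :=
  (cmp_0, cmpD, cmpN, cmpZ, mdotE, cmp_star, cmp_act, @hodgeE R,  etadE R, wedgeE).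

Lemma mdot_star v M : antisym M -> mdot v (star v M) = 0.
Proof. by move=> anti; rewrite !coordE !(antisymE anti); ring. Qed.

Definition pfaffian M : R :=
  M o0 o1 * M o2 o3 - M o0 o2 * M o1 o3 + M o0 o3 * M o1 o2.

(** In dimension four an antisymmetric tensor composed with its Hodge dual is a multiple of the
    identity, the factor being its Pfaffian up to sign. For v = P this makes J W a multiple of P. *)
Lemma act_star v M : antisym M -> act M (star v M) = - pfaffian M *: v.
Proof.
move=> anti; apply: cmp_inj; elim/ord4_ind;
  by rewrite /pfaffian !coordE !(antisymE anti); field.
Qed.

(* The cyclic identity *S_{mu nu} f_rho + cyclic = eps_{mu nu rho sg} (S f)^sg
   (up to sign), contracted with u and v. *)
Lemma star_act f u v S : antisym S ->
  mdot f v *: star u S - mdot f u *: star v S + mdot u (star v S) *: f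
  = -2 *: star u (wedge v (act S f)).
Proof.
move=> anti; apply: cmp_inj; elim/ord4_ind;
  by rewrite !coordE !(antisymE anti); field.
Qed.

(* The dual of star_act: *M and M exchange roles. *)
Lemma act_double d v M : antisym M ->
  mdot v v *: act M d - mdot v (act M d) *: v - mdot d v *: act M v
  = 2 *: star d (wedge v (star v M)).
Proof.
move=> anti; apply: cmp_inj; elim/ord4_ind;
  by rewrite !coordE !(antisymE anti); field.
Qed.

End Vectors.

(** * Causal relations between vectors *)

Section Causality.
Variable R : realType.
Implicit Types (u v w P : 'rV[R]_4).

(** Spatial Cauchy-Schwarz bounds the spatial product strictly by [v0 * p0], since each time
    component exceeds the length of its spatial part. *)
Lemma mdot_future_lt0 v P :
  future_timelike v -> future_timelike P -> mdot v P < 0.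
Proof.
rewrite /future_timelike !mdotE.
set v0 := cmp v o0; set v1 := cmp v o1; set v2 := cmp v o2; set v3 := cmp v o3.
set p0 := cmp P o0; set p1 := cmp P o1; set p2 := cmp P o2; set p3 := cmp P o3.
move=> [v_time v_fut] [p_time p_fut].
have v0_gt0 : 0 < v0 by rewrite /v0 (_ : o0 = ord0) //; apply: val_inj.
have p0_gt0 : 0 < p0 by rewrite /p0 (_ : o0 = ord0) //; apply: val_inj.
set s := v1 * p1 + v2 * p2 + v3 * p3.
have CS : s ^+ 2 <= (v1 ^+ 2 + v2 ^+ 2 + v3 ^+ 2) * (p1 ^+ 2 + p2 ^+ 2 + p3 ^+ 2).
  (* Lagrange's identity: the defect in Cauchy-Schwarz is a sum of squares. *)
  rewrite -subr_ge0 [X in 0 <= X](_ : _ = (v1 * p2 - v2 * p1) ^+ 2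
    + (v1 * p3 - v3 * p1) ^+ 2 + (v2 * p3 - v3 * p2) ^+ 2).
    by rewrite !addr_ge0 ?sqr_ge0.
  by rewrite /s; ring.
have lt_s : s ^+ 2 < (v0 * p0) ^+ 2.
  apply: le_lt_trans CS _; rewrite exprMn.
  by apply: ltr_pM; rewrite ?addr_ge0 ?sqr_ge0 //; lra.
have : `|s| < v0 * p0.
  rewrite -ltr_sqr ?nnegrE ?mulr_ge0 ?(ltW v0_gt0) ?(ltW p0_gt0) //.
  by rewrite real_normK ?num_real.
by rewrite ltr_norml => /andP[_]; rewrite /s; lra.
Qed.

(** If w were causal, orthogonality and Cauchy-Schwarz would bound [(p0 * v0) ^+ 2] by the product
    of the squared spatial lengths, which is strictly smaller than it. *)
Lemma mdot_orthogonal_gt0 w P :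
  future_timelike P -> mdot P w = 0 -> w != 0 -> 0 < mdot w w.
Proof.
move=> [P_time _] Pw0 w_neq0; move: P_time Pw0; rewrite !mdotE.
have w_neq0' : 0 < cmp w o0 ^+ 2 + cmp w o1 ^+ 2 + cmp w o2 ^+ 2 + cmp w o3 ^+ 2.
  rewrite lt_neqAle !addr_ge0 ?sqr_ge0 // andbT eq_sym.
  apply: contra w_neq0.
  rewrite !paddr_eq0 ?addr_ge0 ?sqr_ge0 // !sqrf_eq0 => /andP[/andP[/andP[]]].
  move=> /eqP z0 /eqP z1 /eqP z2 /eqP z3; apply/eqP/cmp_inj.
  by elim/ord4_ind; rewrite ?(z0, z1, z2, z3) cmp_0.
move: w_neq0'.
set v0 := cmp w o0; set v1 := cmp w o1; set v2 := cmp w o2; set v3 := cmp w o3.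
set p0 := cmp P o0; set p1 := cmp P o1; set p2 := cmp P o2; set p3 := cmp P o3.
move=> w_gt0 P_time Pw0.
have CS : (p0 * v0) ^+ 2 <= (v1 ^+ 2 + v2 ^+ 2 + v3 ^+ 2) * (p1 ^+ 2 + p2 ^+ 2 + p3 ^+ 2).
  have -> : p0 * v0 = p1 * v1 + p2 * v2 + p3 * v3 by lra.
  rewrite -subr_ge0 [X in 0 <= X](_ : _ = (v1 * p2 - v2 * p1) ^+ 2
    + (v1 * p3 - v3 * p1) ^+ 2 + (v2 * p3 - v3 * p2) ^+ 2).
    by rewrite !addr_ge0 ?sqr_ge0.
  by ring.
have P_lt : p1 ^+ 2 + p2 ^+ 2 + p3 ^+ 2 < p0 ^+ 2 by lra.
have p_ge0 : 0 <= p1 ^+ 2 + p2 ^+ 2 + p3 ^+ 2 by rewrite !addr_ge0 ?sqr_ge0.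
have v_ge0 : 0 <= v1 ^+ 2 + v2 ^+ 2 + v3 ^+ 2 by rewrite !addr_ge0 ?sqr_ge0.
rewrite ltNge; apply/negP => w_le0.
have le_v : v1 ^+ 2 + v2 ^+ 2 + v3 ^+ 2 <= v0 ^+ 2 by lra.
have v0_gt0 : 0 < v0 ^+ 2 by lra.
move: CS; rewrite exprMn leNgt => /negP; apply.
apply: (@le_lt_trans _ _ (v0 ^+ 2 * (p1 ^+ 2 + p2 ^+ 2 + p3 ^+ 2))).
  by rewrite ler_wpM2r.
by rewrite mulrC ltr_pM2r.
Qed.

Lemma unit_future_timelike u : unit_future u -> future_timelike u.
Proof. by move=> [uu u0]; split=> //; rewrite uu oppr_lt0. Qed.

Lemma mc_gt0 P : future_timelike P -> 0 < mc P.
Proof. by move=> [P_time _]; rewrite sqrtr_gt0 oppr_gt0. Qed.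

Lemma mc_sqr P : future_timelike P -> mdot P P = - mc P ^+ 2.
Proof. by move=> [P_time _]; rewrite sqr_sqrtr ?opprK // oppr_ge0 ltW. Qed.

End Causality.

(** * Supplementary conditions and the centre-of-spin equation *)

Section CentreOfSpin.
Variable R : realType.
Implicit Types (u v w x f P d : 'rV[R]_4) (M : 'M[R]_4) (a tau : R).

Lemma actZ M a v : act M (a *: v) = a *: act M v.
Proof. by apply: cmp_inj => i; rewrite !coordE; ring. Qed.

Lemma actB M u v : act M (u - v) = act M u - act M v.
Proof. by apply: cmp_inj => i; rewrite !coordE; ring. Qed.

Lemma mdot_act_skew M u v : antisym M -> mdot u (act M v) = - mdot v (act M u).
Proof. by move=> anti; rewrite !coordE !(antisymE anti); ring. Qed.

Lemma spin_tensorE x P M i j : spin_tensor x P M i j =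
  M i j - etad R i * cmp x i * (etad R j * cmp P j)
  + etad R j * cmp x j * (etad R i * cmp P i).
Proof. by rewrite mxE /low; ring. Qed.

Lemma spin_tensor_antisym x P M : antisym M -> antisym (spin_tensor x P M).
Proof. by move=> anti i j; rewrite !spin_tensorE (anti i j); ring. Qed.

(** The orbital part of J is a wedge with P, killed when epsilon is contracted with P. So J and
    every spin tensor share the same W. *)
Lemma star_spin_tensor x P M : star P (spin_tensor x P M) = star P M.
Proof.
by apply: cmp_inj; elim/ord4_ind; rewrite !coordE !spin_tensorE !etadE; field.
Qed.

Lemma act_spin_tensor x P M f : act (spin_tensor x P M) f =
  act M f - mdot f P *: x + mdot f x *: P.
Proof.
by apply: cmp_inj; elim/ord4_ind; rewrite !coordE !spin_tensorE !etadE; ring.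
Qed.

Lemma star_wedge0 u v : star u (wedge v 0) = 0.
Proof.
apply: cmp_inj; elim/ord4_ind; rewrite !coordE; ring.
Qed.

Lemma mdot_actE M u f :
  mdot u (act M f) = \sum_(i < 4) \sum_(j < 4) M i j * cmp u i * cmp f j.
Proof. by rewrite !sum_ord4 !coordE; ring. Qed.

(** Isolates f/(f.P), the only way f enters. The coefficient of P is the one forced by u.x =
    -tau. *)
Lemma ssc_posE f u tau P M : ssc_pos f u tau P M =
  act M ((mdot f P)^-1 *: f) +
  ((tau + mdot u (act M ((mdot f P)^-1 *: f))) / - mdot u P) *: P.
Proof.
apply: cmp_inj => i; rewrite {1}/cmp mxE actZ mdotZr mdot_actE.
rewrite cmpD !cmpZ -[in RHS](lowK P) cmp_act sum_ord4 !invrN; ring.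
Qed.

Lemma ssc_pos_spin_supplementary f u tau P M : antisym M -> mdot f P != 0 ->
  act (spin_tensor (ssc_pos f u tau P M) P M) f = 0.
Proof.
move=> anti fP; have ff : mdot f (act M f) = 0.
  by have := mdot_act_skew f f anti; lra.
rewrite act_spin_tensor ssc_posE mdotDr !actZ !mdotZr ff mulr0 add0r.
apply: cmp_inj => i; rewrite !(cmp_0, cmpD, cmpN, cmpZ); set k := _ / - mdot u P.
by field.
Qed.

Definition nw_dir u P := u + (mc P)^-1 *: P.

Lemma mdot_nw_dir u P : future_timelike P ->
  mdot (nw_dir u P) P = mdot u P - mc P.
Proof.
move=> Pf; rewrite mdotDl mdotZl mc_sqr //.
by have := mc_gt0 Pf => /lt0r_neq0 m0; field.
Qed.

(** With g = u + P/(mc), g.P = u.P - mc, and antisymmetry removes u.(J u), so only the P part of g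
    survives in u.(J g). *)
Lemma nw_posE u tau P M : antisym M -> future_timelike P -> unit_future u ->
  nw_pos u tau P M = ssc_pos (nw_dir u P) u tau P M.
Proof.
move=> anti Pf uf.
have m0 := lt0r_neq0 (mc_gt0 Pf).
have uP := mdot_future_lt0 (unit_future_timelike uf) Pf.
have mP := mc_gt0 Pf.
rewrite ssc_posE mdot_nw_dir //.
have uu : mdot u (act M u) = 0 by have := mdot_act_skew u u anti; lra.
have split_act : act M (nw_dir u P) = act M u + (mc P)^-1 *: act M P.
  by apply: cmp_inj => i; rewrite !coordE; ring.
have -> : mdot u (act M ((mdot u P - mc P)^-1 *: nw_dir u P)) =
    (mdot u P - mc P)^-1 * (mc P)^-1 * mdot u (act M P).
  by rewrite actZ split_act mdotZr mdotDr mdotZr uu; ring.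
rewrite mdot_actE; apply: cmp_inj => i.
rewrite cmpD cmpZ actZ cmpZ {1}/cmp mxE.
rewrite -(lowK P) (_ : cmp (act M _) i =
  etad R i * \sum_(j < 4) M i j * (cmp u j + cmp P j / mc P)); last first.
  by rewrite !coordE sum_ord4; ring.
have bm : mdot u P - mc P != 0 by rewrite lt_eqF //; lra.
have mb : mc P - mdot u P != 0 by rewrite gt_eqF //; lra.
field.
by rewrite m0 bm mb ltr0_neq0.
Qed.

Lemma centre_of_spinE u x P M : centre_of_spin_at u x P M ->
  spin_vec u P M = star u (spin_tensor x P M).
Proof.
move=> cs; apply: low_inj => i; rewrite cs {1}/low cmp_star.
by elim/ord4_ind: i; rewrite !etadE; rewrite /hodge; ring.
Qed.

Lemma spin_vecE u P M : antisym M -> spin_vec u P M = (mc P)^-1 *: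
  (star P M + (mdot u (star P M) / (1 - mdot u P / mc P)) *: nw_dir u P).
Proof.
move=> anti; set W := star P M.
have PW : mdot P W = 0 by exact: mdot_star.
have Wc i : etad R i * PL_low P M i = cmp W i by rewrite cmp_star.
apply: cmp_inj => i; rewrite {1}/cmp mxE.
under eq_bigr do rewrite Wc.
(* The P.W terms are kept at first, so that expanding B W is a plain polynomial identity; P.W = 0
   then leaves W and a multiple of g. *)
rewrite [X in X / _](_ : _ = cmp W i
  + cmp (nw_dir u P) i * (mdot P W / mc P + mdot u W) / (1 - mdot u P / mc P)
  - 2 * cmp u i * mdot P W / mc P).
  rewrite PW !cmpZ cmpD cmpZ; ring.
rewrite sum_ord4 /Bmat /low !etadE !mdotE cmpD cmpZ.
by elim/ord4_ind: i; rewrite /=; ring.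
Qed.

Lemma centre_of_spin_dir f u tau P M :
  antisym M -> future_timelike P -> unit_future u -> future_timelike f ->
  centre_of_spin_at u (ssc_pos f u tau P M) P M ->
  mdot u (star P M) *:
    ((mdot f P)^-1 *: f - (mdot (nw_dir u P) P)^-1 *: nw_dir u P)
  = (mdot f u / mdot f P - (mc P)^-1) *: star P M.
Proof.
move=> anti Pf uf ff /centre_of_spinE cs.
have m_gt0 := mc_gt0 Pf; have m0 := lt0r_neq0 m_gt0.
have uP := mdot_future_lt0 (unit_future_timelike uf) Pf.
have fP := ltr0_neq0 (mdot_future_lt0 ff Pf).
(* At v = P the right-hand side vanishes because S f = 0, leaving (f.P) s(u) = (f.u) W - (u.W) f up
   to the normalisation of s(u) already in [spin_vecE]. *)
have := star_act f u P (spin_tensor_antisym (ssc_pos f u tau P M) P anti).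
rewrite ssc_pos_spin_supplementary // star_wedge0 scaler0 star_spin_tensor.
rewrite -cs spin_vecE // mdot_nw_dir // => E.
apply: cmp_inj => i; have := congr1 (fun v => cmp v i) E.
rewrite !(cmp_0, cmpN, cmpD, cmpZ).
set W := cmp (star P M) i; set q := mdot u (star P M).
set b := mdot u P in uP *; set m := mc P in m_gt0 m0 *.
move=> H.
have bm : b - m != 0 by rewrite lt_eqF //; lra.
have bm' : m - b != 0 by rewrite gt_eqF //; lra.
have {}H : q * cmp f i = mdot f u * W - mdot f P * (m^-1 * (W + q / (1 - b / m) *
   (cmp u i + m^-1 * cmp P i))) by move: H; lra.
rewrite mulrDr mulrCA H.
by field; rewrite bm bm' m0 fP.
Qed.

(** Both points lie on lines parallel to P. When J d is proportional to P the lines coincide, and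
    u.P nonzero makes their intersection with the hyperplane unique. *)
Lemma ssc_pos_eq f g u tau P M k : mdot u P != 0 ->
  act M ((mdot f P)^-1 *: f - (mdot g P)^-1 *: g) = k *: P ->
  ssc_pos f u tau P M = ssc_pos g u tau P M.
Proof.
move=> uP; rewrite actB => /eqP; rewrite subr_eq => /eqP E.
rewrite !ssc_posE E mdotDr mdotZr; apply: cmp_inj => i.
by rewrite !(cmpN, cmpD, cmpZ); field.
Qed.

Lemma centre_of_spin_transverse f u tau P M :
  antisym M -> future_timelike P -> unit_future u -> future_timelike f ->
  centre_of_spin_at u (ssc_pos f u tau P M) P M ->
  mdot u (star P M) != 0 ->
  ssc_pos f u tau P M = nw_pos u tau P M.
Proof.
move=> anti Pf uf ff cs uW; rewrite nw_posE //.
have uP := ltr0_neq0 (mdot_future_lt0 (unit_future_timelike uf) Pf).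
have := centre_of_spin_dir anti Pf uf ff cs; set d := _ - _; set l := _ - _ => E.
(* The factor combines d = (l / u.W) W with J W = -Pf(J) P. *)
apply: (@ssc_pos_eq _ _ _ _ _ _ (- (l / mdot u (star P M)) * pfaffian M)) => //.
rewrite -/d.
have -> : d = (l / mdot u (star P M)) *: star P M.
  by rewrite mulrC -scalerA -E scalerA mulVf // scale1r.
by rewrite actZ act_star // scalerA mulrN mulNr.
Qed.

Lemma ssc_pos_spinless f u tau P M :
  antisym M -> future_timelike P -> unit_future u -> future_timelike f ->
  star P M = 0 -> ssc_pos f u tau P M = nw_pos u tau P M.
Proof.
move=> anti Pf uf ff W0; rewrite nw_posE //.
have [PP _] := Pf.
have uP := mdot_future_lt0 (unit_future_timelike uf) Pf.
have fP := ltr0_neq0 (mdot_future_lt0 ff Pf).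
have gP : mdot (nw_dir u P) P != 0.
  by rewrite mdot_nw_dir // lt_eqF //; have := mc_gt0 Pf; lra.
pose d := (mdot f P)^-1 *: f - (mdot (nw_dir u P) P)^-1 *: nw_dir u P.
(* Both normalised directions have product 1 with P. With W = 0 as well, [act_double] at v = P
   reduces to (P.P) J d = (P.J d) P. *)
have dP : mdot d P = 0 by rewrite mdotBl !mdotZl !mulVf // subrr.
apply: (@ssc_pos_eq _ _ _ _ _ _ (mdot P (act M d) / mdot P P)).
  exact: ltr0_neq0.
rewrite -/d; have := act_double d P anti.
rewrite W0 star_wedge0 dP scale0r scaler0 subr0 => /eqP.
rewrite subr_eq0 => /eqP E.
by rewrite mulrC -scalerA -E scalerA mulVf ?scale1r // ltr0_neq0.
Qed.

End CentreOfSpin.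

(** * Approximating a hyperplane by nearby ones with u.W nonzero *)

Section Approximation.
Variable R : realType.
Implicit Types (u w P : 'rV[R]_4) (M : 'M[R]_4) (t tau : R).

(* Rational parametrisation of the hyperbola through u in the plane of u and w,
   for w orthogonal to u. *)
Definition boost_curve u w t : 'rV[R]_4 :=
  (1 - t ^+ 2 * mdot w w)^-1 *: ((1 + t ^+ 2 * mdot w w) *: u + (2 * t) *: w).

(** With s = t^2 (w.w), this is the identity (1 + s)^2 - 4 s = (1 - s)^2. *)
Lemma mdot_boost_curve u w t : mdot u u = -1 -> mdot u w = 0 ->
  1 - t ^+ 2 * mdot w w != 0 ->
  mdot (boost_curve u w t) (boost_curve u w t) = -1.
Proof.
move=> uu uw nz; rewrite mdotZl mdotZr mdotDl !mdotDr !mdotZl !mdotZr.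
by rewrite (mdotC w u) uu uw; field.
Qed.

Lemma mdot_boost_curve_dir u w t : mdot u w = 0 ->
  mdot (boost_curve u w t) w =
  (1 - t ^+ 2 * mdot w w)^-1 * (2 * t * mdot w w).
Proof. by move=> uw; rewrite mdotZl mdotDl !mdotZl uw; ring. Qed.

Lemma cvg_cmp (T : Type) (F : set_system T) (FF : Filter F)
  (x : T -> 'rV[R]_4) u i : x @ F --> u ->
  (fun z => cmp (x z) i) @ F --> cmp u i.
Proof.
move=> xu; apply: (@cvg_comp _ _ _ x (fun v : 'rV[R]_4 => cmp v i) _ _ _ xu).
exact: coord_continuous.
Qed.

Lemma cvg_dnbhs_id (a : R) : (fun t => t) @ a^' --> a.
Proof. exact: cvg_within. Qed.

Lemma denominator_cvg (q : R) : (fun t => 1 - t ^+ 2 * q) @ 0^' --> (1 : R).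
Proof.
rewrite -[X in _ --> X](_ : 1 - 0 ^+ 2 * q = 1); last by ring.
apply: cvgB; first exact: cvg_cst.
by apply: cvgM; [apply: cvgM; exact: cvg_dnbhs_id|exact: cvg_cst].
Qed.

Lemma boost_curve_cvg u w : boost_curve u w @ 0^' --> u.
Proof.
rewrite -[X in _ --> X](_ :
  1^-1 *: ((1 + 0 ^+ 2 * mdot w w) *: u + (2 * 0) *: w) = u); last first.
  by rewrite invr1 scale1r mulr0 scale0r addr0 expr0n mul0r addr0 scale1r.
apply: cvgZ.
  by apply: cvgV; [exact: oner_neq0|exact: denominator_cvg].
apply: cvgD; apply: cvgZ; try exact: cvg_cst.
  apply: cvgD; first exact: cvg_cst.
  by apply: cvgM; [apply: cvgM; exact: cvg_dnbhs_id|exact: cvg_cst].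
by apply: cvgM; [exact: cvg_cst|exact: cvg_dnbhs_id].
Qed.

Lemma boost_curve_SpHP u w : unit_future u -> mdot u w = 0 ->
  \forall t \near 0^', unit_future (boost_curve u w t).
Proof.
move=> [uu u0] uw.
have d_gt0 : \forall t \near 0^', 0 < 1 - t ^+ 2 * mdot w w.
  exact: (cvgr_gt _ (denominator_cvg (mdot w w)) _ ltr01).
have c_gt0 : \forall t \near 0^', 0 < cmp (boost_curve u w t) ord0.
  exact: (cvgr_gt _ (cvg_cmp (i := ord0) _ (@boost_curve_cvg u w)) _ u0).
apply: filterS2 d_gt0 c_gt0 => t d0 c0; split=> //.
by apply: mdot_boost_curve => //; exact: lt0r_neq0.
Qed.

(** The product with w is 2 t (w.w) / (1 - t^2 (w.w)), which vanishes at t = 0; hence the punctured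
    neighbourhood. *)
Lemma boost_curve_transverse u w : mdot u w = 0 -> mdot w w != 0 ->
  \forall t \near 0^', mdot (boost_curve u w t) w != 0.
Proof.
move=> uw ww.
have d_gt0 : \forall t \near 0^', 0 < 1 - t ^+ 2 * mdot w w.
  exact: (cvgr_gt _ (denominator_cvg (mdot w w)) _ ltr01).
apply: filterS2 d_gt0 (nbhs_dnbhs_neq (0 : R)) => t d0 t0.
by rewrite mdot_boost_curve_dir // !mulf_neq0 ?invr_neq0 ?(lt0r_neq0 d0) ?pnatr_eq0.
Qed.

(** Each component is rational in u, with denominators built from mc, mc - u.P and -u.P, all
    positive at the limit. *)
Lemma nw_pos_cvg (T : Type) (F : set_system T) (FF : Filter F)
  (x : T -> 'rV[R]_4) u tau P M i :
  future_timelike P -> unit_future u -> x @ F --> u ->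
  (fun z => cmp (nw_pos (x z) tau P M) i) @ F --> cmp (nw_pos u tau P M) i.
Proof.
move=> Pf uf xu.
have xi j := cvg_cmp (i := j) FF xu.
have xP : (fun z => mdot (x z) P) @ F --> mdot u P.
  under eq_fun do rewrite mdotE. rewrite mdotE.
  repeat first [exact: xi | exact: cvg_cst | apply: cvgD | apply: cvgN | apply: cvgM].
have m0 := mc_gt0 Pf.
have uP := mdot_future_lt0 (unit_future_timelike uf) Pf.
have nz1 : mc P - mdot u P != 0 by rewrite gt_eqF //; lra.
have nz2 : - mdot u P != 0 by rewrite gt_eqF //; lra.
have linear_cvg : (fun z => \sum_(rho < 4)
      M i rho * (cmp (x z) rho + cmp P rho / mc P)) @ F -->
    \sum_(rho < 4) M i rho * (cmp u rho + cmp P rho / mc P).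
  apply: (cvg_big add_continuous) => j _; apply: cvgM; first exact: cvg_cst.
  by apply: cvgD; [exact: xi|exact: cvg_cst].
have bilinear_cvg : (fun z => \sum_(la < 4) \sum_(rho < 4)
      M la rho * cmp (x z) la * cmp P rho) @ F -->
    \sum_(la < 4) \sum_(rho < 4) M la rho * cmp u la * cmp P rho.
  apply: (cvg_big add_continuous) => j _; apply: (cvg_big add_continuous) => k _.
  by apply: cvgM; [apply: cvgM; [exact: cvg_cst|exact: xi]|exact: cvg_cst].
have gap_cvg : (fun z => mc P - mdot (x z) P) @ F --> mc P - mdot u P.
  by apply: cvgB; [exact: cvg_cst|exact: xP].
have inv_cvg : (fun z => (- mdot (x z) P)^-1) @ F --> (- mdot u P)^-1.
  by apply: cvgV => //; apply: cvgN; exact: xP.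
under eq_fun do rewrite /cmp mxE.
rewrite /cmp mxE; apply: cvgM; first exact: cvg_cst.
apply: cvgB.
  apply: cvgD; last by apply: cvgM; [exact: cvg_cst|exact: inv_cvg].
  by apply: cvgM; [apply: cvgN; exact: linear_cvg|apply: cvgV].
apply: cvgM; last by apply: cvgM; [exact: cvg_cst|exact: inv_cvg].
apply: cvgM; first exact: bilinear_cvg.
apply: cvgV; first by rewrite mulf_neq0 // lt0r_neq0.
by apply: cvgM; [exact: cvg_cst|exact: gap_cvg].
Qed.

End Approximation.

Theorem mainTheorem5 (R : realType) (c : R) (Gamma : Type)
  (P : Gamma -> 'rV[R]_4) (J : Gamma -> 'M[R]_4)
  (chi : 'rV[R]_4 -> R -> Gamma -> 'rV[R]_4) :
  0 < c ->
  (* Poincare-invariant system: antisymmetric J, future timelike P *)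
  (forall g mu nu, J g mu nu = - J g nu mu) ->
  (forall g, future_timelike (P g)) ->
  (* chi is a position observable *)
  (forall u tau g, SpHP (u, tau) -> mdot u (chi u tau g) = - tau) ->
  (forall u tau g, SpHP (u, tau) ->
     is_derive tau 1 (fun t => chi u t g) ((- mdot u (P g))^-1 *: P g)) ->
  (* chi is SSC w.r.t. some future-timelike-valued f *)
  (exists f : 'rV[R]_4 -> R -> Gamma -> 'rV[R]_4,
     (forall u tau g, SpHP (u, tau) -> future_timelike (f u tau g)) /\
     (forall u tau g, SpHP (u, tau) ->
        chi u tau g = ssc_pos (f u tau g) u tau (P g) (J g))) ->
  (* continuity of Sigma |-> chi(Sigma)(gamma) *)
  (forall g, {within @SpHP R, continuous (fun p : 'rV[R]_4 * R => chi p.1 p.2 g)}) ->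
  (* chi is a centre of spin *)
  (forall u tau g, SpHP (u, tau) ->
     centre_of_spin_at u (chi u tau g) (P g) (J g)) ->
  forall u tau g, SpHP (u, tau) -> chi u tau g = nw_pos u tau (P g) (J g).
Proof.
move=> _ anti Pf _ _ [f [ff chiE]] chi_cont cs u tau g uS.
set W := star (P g) (J g).
have transverse v : unit_future v -> mdot v W != 0 ->
    chi v tau g = nw_pos v tau (P g) (J g).
  move=> vf vW; have vS : SpHP (v, tau) by [].
  rewrite chiE //; apply: centre_of_spin_transverse => //.
  - exact: ff.
  - by rewrite -chiE //; exact: cs.
have [W0|W_neq0] := eqVneq W 0.
  by rewrite chiE //; apply: ssc_pos_spinless => //; exact: ff.
have [uW|] := eqVneq (mdot u W) 0; last exact: transverse.
have WW : mdot W W != 0.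
  apply: lt0r_neq0; apply: mdot_orthogonal_gt0 (Pf g) _ W_neq0.
  exact: mdot_star.
have uf : unit_future u := uS.
have curve_cvg := @boost_curve_cvg _ u W.
have curve_SpHP := boost_curve_SpHP uf uW.
have chi_cvg : (fun t => chi (boost_curve u W t) tau g) @ 0^' --> chi u tau g.
  have /subspace_continuousP cont := chi_cont g.
  have pair_cvg : (fun t => (boost_curve u W t, tau)) @ 0^' --> (u, tau).
    exact: cvg_pair curve_cvg (cvg_cst tau).
  (* Continuity of chi holds only relative to [SpHP], so the curve must converge in the trace
     filter; it stays on the hyperboloid for small nonzero t. *)
  have within_cvg : (fun t => (boost_curve u W t, tau)) @ 0^' -->
      within SpHP (nbhs (u, tau)).
    by move=> B wB; apply: filterS2 curve_SpHP (pair_cvg _ wB) => t St; exact.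
  exact: cvg_comp within_cvg (cont _ uS).
apply: cmp_inj => i.
have chi_i := cvg_cmp (i := i) (dnbhs_filter (0 : R)) chi_cvg.
have nw_i := nw_pos_cvg (tau := tau) (M := J g) (i := i)
  (dnbhs_filter (0 : R)) (Pf g) uf curve_cvg.
(* Along the curve both observables agree for small nonzero t, so their limits at u agree. *)
apply: (cvg_unique (@Rhausdorff R) chi_i).
apply: cvg_trans nw_i.
apply: near_eq_cvg.
apply: filterS2 curve_SpHP (boost_curve_transverse uW WW) => t St tW.
by rewrite transverse.
Qed.
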